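(* Let $\mathcal{G}$ be a subgroup-closed class of groups. For each $k\ge 2$, the graphs $W_{2k}$ and $2C_{2k}$ are bad (i.e. not good with respect to $\mathcal{G}$) if any of $\mathbb{Z}_3,\mathbb{Z}_5,\dots,\mathbb{Z}_{2k-1}$ belongs to $\mathcal{G}$.
   Context: Graphs may have loops and multiple edges. A gain graph $(\Gamma,g,G)$ is a graph $\Gamma=(V,E)$, a group $G$ (the gain group), and a homomorphism $g:F(E)\to G$ from the free group on $E$. Each edge $e$ has an arbitrary fixed orientation and $e^{-1}$ denotes the same edge in the opposite direction, so $g(e^{-1})=g(e)^{-1}$; the gain of a walk is the product, in order, of the gains of its (directed) edges. A circle is the edge set of a simple closed walk (nontrivial, no repeated vertex or edge except that initial and final vertices coincide; loops and pairs of parallel links are circles). A circle is balanced if the corresponding simple closed walk has gain $1$. The gain graph is balanced if every circle is balanced. $Z_1(\Gamma;\mathbb{Z}_2)$ is the group of binary cycles (edge sets of even degree at every vertex, under symmetric difference). A graph $\Gamma$ is good with respect to $\mathcal{G}$ if for every gain graph $(\Gamma,g,G)$ with $G\in\mathcal{G}$, the existence of a basis of $Z_1(\Gamma;\mathbb{Z}_2)$ consisting of balanced circles implies that $(\Gamma,g,G)$ is balanced; otherwise $\Gamma$ is bad. Classes of groups are closed under isomorphism; subgroup-closed means closed under taking subgroups. $W_n$ is the wheel with $n$ spokes (a rim circle of length $n$ and a hub joined to each rim vertex by one edge). $2C_n$ is the circle graph of length $n$ with every edge replaced by two parallel copies. *)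

(* Defs.v *)
From HB Require Import structures.
From mathcomp Require Import all_boot all_order all_algebra all_fingroup.

Set Implicit Arguments.
Unset Strict Implicit.
Unset Printing Implicit Defensive.

Import GroupScope.

(* Finite graphs; loops and multiple edges are allowed.  The orientation of
   each edge from [src] to [tgt] is the arbitrary fixed one used for gains. *)
Record graph := Graph {
  vertex : finType;
  edge : finType;
  src : edge -> vertex;
  tgt : edge -> vertex
}.

Section Walks.
Variable Gam : graph.
Implicit Types (D : {set edge Gam}) (w : seq (edge Gam * bool)).

(* [(e, true)] is e in its fixed direction, [(e, false)] is e^-1. *)
Definition dart : Type := (edge Gam * bool)%type.
Definition dart_tail (d : dart) : vertex Gam :=
  if d.2 then src d.1 else tgt d.1.
Definition dart_head (d : dart) : vertex Gam :=
  if d.2 then tgt d.1 else src d.1.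

Definition edge_set w : {set edge Gam} := [set:: [seq d.1 | d <- w]].

(* Forbidding repeated edges excludes the walks e e^-1 on a single link. *)
Definition simple_closed_walk w : bool :=
  [&& w != [::],
      path.cycle (fun d1 d2 : dart => dart_head d1 == dart_tail d2) w,
      uniq [seq dart_tail d | d <- w]
    & uniq [seq d.1 | d <- w]].

Definition circle D : Prop :=
  exists2 w, simple_closed_walk w & edge_set w = D.

(* A loop contributes 2 to the degree of its vertex. *)
Definition degree D (v : vertex Gam) : nat :=
  #|[set e in D | src e == v]| + #|[set e in D | tgt e == v]|.

Definition binary_cycle D : bool := [forall v, ~~ odd (degree D v)].

(* Edge sets under symmetric difference, as vectors over the field 'F_2. *)
Definition edge_space : vectType 'F_2 := {ffun edge Gam -> ('F_2)^o}.
Definition indicator D : edge_space := [ffun e => (e \in D)%:R%R].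

(* The span adds nothing to the binary cycles: see [mem_cycle_space]. *)
Definition cycle_space : {vspace edge_space} :=
  <<[seq indicator D | D in binary_cycle]>>%VS.

Definition cycle_basis (B : seq {set edge Gam}) : bool :=
  basis_of cycle_space [seq indicator D | D <- B].

Section Gains.
Variable G : groupType.
(* A homomorphism F(E) -> G, given by its (arbitrary) values on the free
   generators; [walk_gain] is its value on words in the edges and inverses. *)
Variable g : edge Gam -> G.

Definition dart_gain (d : dart) : G := if d.2 then g d.1 else (g d.1)^-1.
Definition walk_gain w : G := \prod_(d <- w) dart_gain d.

(* The simple closed walk on a circle is unique up to starting point and
   direction, which only conjugate or invert its gain. *)
Definition balanced_circle D : Prop :=
  exists2 w, simple_closed_walk w /\ edge_set w = D & walk_gain w = 1.

Definition balanced : Prop := forall D, circle D -> balanced_circle D.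
End Gains.

Lemma mem_cycle_space D : (indicator D \in cycle_space) = binary_cycle D.
Proof.
pose bd v (x : edge_space) : 'F_2 :=
  (\sum_(e | src e == v) x e + \sum_(e | tgt e == v) x e)%R.
have bdE D' v : bd v (indicator D') = (odd (degree D' v))%:R%R.
  have sumE (p : pred (edge Gam)) :
      (\sum_(e | p e) indicator D' e = #|[set e in D' | p e]|%:R :> 'F_2)%R.
    under eq_bigr do rewrite ffunE.
    rewrite -GRing.natr_sum -big_mkcondr sum1_card.
    by congr (_%:R)%R; apply: eq_card => e; rewrite !inE andbC.
  rewrite /bd !sumE -GRing.natrD -/(degree D' v).
  rewrite -[in LHS](odd_double_half (degree D' v)) -muln2.
  have F2 : (2%:R = 0 :> 'F_2)%R by apply/val_inj.
  by rewrite GRing.natrD GRing.natrM F2 GRing.mulr0 GRing.addr0.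
apply/idP/forallP => [xD v | evD]; last first.
  by apply/memv_span/image_f/forallP.
have bd0 : bd v (indicator D) = 0%R.
  rewrite (coord_span xD).
  rewrite /bd; under eq_bigr do rewrite sum_ffunE.
  under [X in (_ + X)%R]eq_bigr do rewrite sum_ffunE.
  rewrite exchange_big [X in (_ + X)%R]exchange_big /= -big_split /=.
  apply: big1 => i _.
  have /imageP[D' evD' ->] : (image_tuple indicator binary_cycle)`_i%R
      \in [seq indicator D | D in binary_cycle].
    by apply: mem_nth; rewrite size_image.
  under eq_bigr do rewrite ffunE.
  under [X in (_ + X)%R]eq_bigr do rewrite ffunE.
  rewrite -!GRing.mulr_sumr -GRing.mulrDr -/(bd v (indicator D')) bdE.
  by rewrite (negPf (forallP evD' v)) GRing.mulr0.
by move: bd0; rewrite bdE; case: odd.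
Qed.

End Walks.

Definition group_class := groupType -> Prop.

Definition iso_closed (C : group_class) : Prop :=
  forall (G H : groupType) (f : {multiplicative G -> H}),
    bijective f -> C G -> C H.

Definition subgroup_closed (C : group_class) : Prop :=
  forall (G : groupType) (S : pred G) (H : subGroupType S), C G -> C H.

Definition good (C : group_class) (Gam : graph) : Prop :=
  forall (G : groupType) (g : edge Gam -> G), C G ->
    (exists2 B : seq {set edge Gam},
       cycle_basis B & forall D, D \in B -> balanced_circle g D) ->
    balanced g.

Definition bad (C : group_class) (Gam : graph) : Prop := ~ good C Gam.

(* The hub is [None]; [inl i] is the rim edge from i to i + 1 modulo n, and
   [inr i] is the spoke from the hub to i. *)
Definition wheel (n : nat) : graph :=
  @Graph (option 'I_n) ('I_n + 'I_n)%type
    (fun e => match e with inl i => Some i | inr _ => None end)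
    (fun e => match e with inl i => Some (ordS i) | inr i => Some i end).

(* [(i, false)] and [(i, true)] are the two copies of the edge from i to
   i + 1 modulo n. *)
Definition doubled_circle (n : nat) : graph :=
  @Graph 'I_n ('I_n * bool)%type (fun e => e.1) (fun e => ordS e.1).

(* The group structure on 'Z_m is the additive one. *)
Fact mulg_Zp m (x y : 'Z_m) : x * y = (x + y)%R.
Proof. by []. Qed.

(* Main.v *)
Require Import Defs.
From mathcomp Require Import all_boot all_order all_algebra all_fingroup.

(* Give each rim edge of [wheel n] (each [true] edge of [doubled_circle n]) the
   gain 1 in Z_m if its index is at most m and the gain 0 otherwise, and every
   other edge the gain 0; here m < n is odd.  Let T i be the triangle (digon) on
   the i-th edge, R the rim (the circle of all [true] edges), and P i = R + T i,
   again a circle.  For i <= m the circle P i has gain m = 0, for i > m the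
   circle T i has gain 0, while T 0 is unbalanced.  As m + 1 is even, the
   balanced circles P i (i <= m) and T i (i > m) sum to the sum of all T i, which
   is R (for [doubled_circle]: R plus the balanced circle of all [false] edges).
   So balanced circles span R, hence every T i, hence the cycle space, and a
   basis can be extracted from them. *)

Set Implicit Arguments.
Unset Strict Implicit.
Unset Printing Implicit Defensive.

Import GRing.Theory GroupScope.

(** * Extraction of a free subfamily with the same span *)

Lemma free_subseq_span (K : fieldType) (V : vectType K) (I : eqType)
    (f : I -> V) (s : seq I) :
  exists B, [/\ {subset B <= s}, free (map f B)
              & <<map f B>>%VS = <<map f s>>%VS].
Proof.
elim: s => [|x s [B [sBs freeB spanB]]]; first by exists [::]; rewrite nil_free.
have [fx_in | fx_notin] := boolP (f x \in <<map f B>>%VS).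
  exists B; split=> //; first by move=> y /sBs; rewrite inE orbC => ->.
  rewrite /= span_cons -spanB; apply/esym/addv_idPr.
  by rewrite -memvE.
exists (x :: B); split; last by rewrite /= !span_cons spanB.
  by move=> y; rewrite !inE => /predU1P[->|/sBs ->]; rewrite ?eqxx ?orbT.
by rewrite /= free_cons fx_notin.
Qed.

(** * Closed walks as binary cycles, and tests for balance *)

Section Graphs.
Variable Gam : graph.

Lemma mem_edge_set (w : seq (dart Gam)) e :
  (e \in edge_set w) = (e \in [seq d.1 | d <- w]).
Proof. by rewrite /edge_set inE. Qed.

(** Reversing a dart swaps its tail and head, so only the sum of the two counts is independent of
    directions. *)
Lemma uniq_degree (w : seq (dart Gam)) v : uniq [seq d.1 | d <- w] ->
  degree (edge_set w) v
    = count (fun d => dart_tail d == v) w + count (fun d => dart_head d == v) w.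
Proof.
move=> Uw.
have cardE (p : pred (edge Gam)) :
    #|[set e in edge_set w | p e]| = count (fun d => p d.1) w.
  rewrite -[RHS](count_map (fun d : dart Gam => d.1) p) -size_filter.
  rewrite -(card_uniqP (filter_uniq p Uw)).
  by apply: eq_card => e; rewrite inE mem_edge_set mem_filter andbC.
rewrite /degree !cardE {Uw cardE}.
elim: w => //= -[e b] w IHw; rewrite addnACA IHw [RHS]addnACA; congr (_ + _).
by rewrite /dart_tail /dart_head /=; case: b => //; rewrite addnC.
Qed.

(* Along a closed walk the heads are the tails shifted by one. *)
Lemma simple_closed_walk_binary w :
  simple_closed_walk w -> binary_cycle (edge_set (w : seq (dart Gam))).
Proof.
case/and4P=> _ cw _ Uw; apply/forallP=> v; rewrite uniq_degree //.
suff -> : count (fun d => dart_head d == v) w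
        = count (fun d => dart_tail d == v) w by rewrite addnn odd_double.
suff Hht : [seq dart_head d | d <- w] = rot 1 [seq dart_tail d | d <- w].
  rewrite -[LHS](count_map (@dart_head Gam) (pred1 v)).
  rewrite -[RHS](count_map (@dart_tail Gam) (pred1 v)) Hht.
  by apply/seq.permP; rewrite perm_rot.
case: w cw {Uw} => // d w; rewrite /= rot1_cons -map_rcons.
elim: w {1 3}d => [|d' w IHw] d0 /=; first by rewrite andbT => /eqP->.
by case/andP=> /eqP-> /IHw ->.
Qed.

Lemma indicatorE (D : {set edge Gam}) e : indicator D e = ((e \in D)%:R)%R.
Proof. by rewrite ffunE. Qed.

(** A vector over ['F_2] is the indicator of its support, so [mem_cycle_space] applies to it. *)
Lemma cycle_spaceP (x : edge_space Gam) :
  x \in cycle_space Gam -> exists2 D, binary_cycle D & x = indicator D.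
Proof.
have xE : x = indicator [set e | x e != 0%R].
  apply/ffunP=> e; rewrite indicatorE inE.
  by case: (x e) => -[|[|i]] // Hi; apply/val_inj.
by rewrite {1}xE mem_cycle_space; exists [set e | x e != 0%R].
Qed.

Section Gains.
Variables (G : groupType) (g : edge Gam -> G).

Lemma balanced_circle_binary D : balanced_circle g D -> binary_cycle D.
Proof. by case=> w [sw <-] _; apply: simple_closed_walk_binary. Qed.

(** Balanced circles are binary cycles, so their span is exactly the cycle space. The list of edge
    sets itself is thinned out, which keeps every basis member balanced. *)
Lemma balanced_basis_of_span (s : seq {set edge Gam}) :
    (forall D, D \in s -> balanced_circle g D) ->
    (cycle_space Gam <= <<[seq indicator D | D <- s]>>)%VS ->
  exists2 B : seq {set edge Gam},
    cycle_basis B & forall D, D \in B -> balanced_circle g D.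
Proof.
move=> bal_s span_s.
have [B [sBs freeB spanB]] := free_subseq_span (@indicator Gam) s.
exists B => [|D /sBs/bal_s //].
rewrite /cycle_basis /basis_of freeB andbT spanB eqEsubv span_s andbT.
apply/span_subvP=> _ /mapP[D /bal_s balD ->].
by rewrite mem_cycle_space balanced_circle_binary.
Qed.

Lemma walk_gain_notin (w : seq (dart Gam)) :
    (forall e, e \in [seq d.1 | d <- w] -> g e = 1) ->
  walk_gain g w = 1.
Proof.
rewrite /walk_gain; elim: w => [|[e b] w IHw] gw; first by rewrite big_nil.
rewrite big_cons IHw => [|e' we']; last by rewrite gw // inE we' orbT.
by rewrite /dart_gain gw ?inE ?eqxx //= invg1 mulg1 if_same.
Qed.

Lemma walk_gain_single (w : seq (dart Gam)) e0 :
    uniq [seq d.1 | d <- w] -> e0 \in [seq d.1 | d <- w] ->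
    (forall e, e \in [seq d.1 | d <- w] -> e != e0 -> g e = 1) ->
  walk_gain g w = 1 -> g e0 = 1.
Proof.
elim: w => // -[e b] w IHw /= /andP[e_w Uw]; rewrite inE.
have [e0E _ gw | e_ne /= e0w gw] := eqVneq e0 e.
  rewrite -e0E in e_w *; rewrite /walk_gain big_cons -/(walk_gain g w).
  rewrite walk_gain_notin => [|e' we'].
    rewrite mulg1 /dart_gain /=; case: b => // /(congr1 invg).
    by rewrite invgK invg1.
  apply: gw; first by rewrite inE we' orbT.
  by apply: contraNneq e_w => <-.
rewrite /walk_gain big_cons /dart_gain /= gw ?inE ?eqxx 1?eq_sym //.
rewrite invg1 if_same mul1g; apply: IHw => // e' we'.
by apply: gw; rewrite inE we' orbT.
Qed.

(** Every simple closed walk on [D] has gain [g e0] or its inverse, so no choice of starting point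
    or direction can witness balance. *)
Lemma unbalanced_single D e0 : circle D -> e0 \in D -> g e0 != 1 ->
  (forall e, e \in D -> e != e0 -> g e = 1) -> ~ balanced g.
Proof.
move=> circD De0 ge0 gD /(_ D circD)[w [/and4P[_ _ _ Uw] Dw] gw].
case/negP: ge0; apply/eqP; apply: walk_gain_single Uw _ _ gw.
  by rewrite -mem_edge_set Dw.
by move=> e; rewrite -mem_edge_set Dw; apply: gD.
Qed.

End Gains.
End Graphs.

(** * Sums modulo 2 *)

Lemma F2_addvv (V : lmodType 'F_2) (x : V) : (x + x = 0)%R.
Proof.
rewrite -mulr2n -scaler_nat.
have -> : (2%:R = 0 :> 'F_2)%R by apply/val_inj.
by rewrite scale0r.
Qed.

(* As [q] is even, the vectors assumed to lie in [U] sum to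
   [q R + \sum_i T i = R + z]. *)
Lemma complemented_family_mem (V : vectType 'F_2) (U : {vspace V}) n q
    (T P : 'I_n -> V) (R z : V) :
    ~~ odd q -> (q <= n)%N ->
    (forall i, T i + P i = R)%R -> (\sum_i T i = R + z)%R -> z \in U ->
    (forall i : 'I_n, (if (i < q)%N then P i else T i) \in U) ->
  forall i, T i \in U.
Proof.
move=> q_even le_qn TP sumT Uz UPT.
have PE i : P i = (R + T i)%R.
  by rewrite -(TP i) addrAC F2_addvv add0r.
have UR : R \in U.
  have : (\sum_(i < n) (if (i < q)%N then P i else T i) \in U)%R.
    by apply: memv_suml.
  have -> : (\sum_(i < n) (if (i < q)%N then P i else T i)
             = \sum_(i < n) (if (i < q)%N then R else 0) + \sum_i T i)%R.
    rewrite -big_split /=; apply: eq_bigr => i _.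
    by case: ifP => _; rewrite ?PE ?add0r.
  rewrite -big_mkcond /= (big_ord_narrow le_qn) sumr_const card_ord.
  rewrite -(odd_double_half q) (negPf q_even) add0n -mul2n mulrnA.
  rewrite mulr2n F2_addvv mul0rn add0r sumT => URz.
  by rewrite -(addrK z R) memvB.
move=> i; have := UPT i; case: ifP => // _; rewrite PE => URT.
by rewrite -(addKr R (T i)) memvD // memvN.
Qed.

(** * The cyclic successor [ordS] and sums over indices *)

Section Cyclic.
Variable n : nat.
Implicit Types a i j : 'I_n.

Lemma val_iter_ordS a t : iter t (@ordS n) a = (a + t) %% n :> nat.
Proof.
elim: t => [|t IHt] /=; first by rewrite addn0 modn_small.
by rewrite IHt -addn1 modnDml addn1 addnS.
Qed.

Lemma fconnect_ordS a i : fconnect (@ordS n) a i.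
Proof.
suff -> : i = iter (n - a + i) (@ordS n) a by apply: fconnect_iter.
apply: val_inj; rewrite /= val_iter_ordS addnA subnKC 1?ltnW //.
by rewrite modnDl modn_small.
Qed.

Lemma orbit_ordS a : fingraph.orbit (@ordS n) a = traject (@ordS n) a n.
Proof.
rewrite /fingraph.orbit /fingraph.order; congr traject; rewrite -[RHS]card_ord.
by apply: eq_card => i; rewrite inE fconnect_ordS.
Qed.

Lemma mem_orbit_ordS a i : i \in fingraph.orbit (@ordS n) a.
Proof. by rewrite -fconnect_orbit fconnect_ordS. Qed.

Lemma uniq_traject_ordS a l : l <= n -> uniq (traject (@ordS n) a l).
Proof.
move=> le_ln; rewrite -(take_traject _ _ le_ln) take_uniq // -orbit_ordS.
exact: orbit_uniq.
Qed.

Lemma iter_ordS_n a : iter n (@ordS n) a = a.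
Proof. by apply: val_inj; rewrite /= val_iter_ordS modnDr modn_small. Qed.

(** The orbit of [ordS a] lists each index once and ends with [a]; dropping its last entry removes
    exactly [a]. *)
Lemma mem_traject_ordS a i : (i \in traject (@ordS n) (ordS a) n.-1) = (i != a).
Proof.
have n_gt0 : 0 < n by case: n a => // -[].
have iter_a : iter n.-1 (@ordS n) (ordS a) = a.
  by rewrite -iterSr prednK ?iter_ordS_n.
have orbE : fingraph.orbit (@ordS n) (ordS a)
    = rcons (traject (@ordS n) (ordS a) n.-1) a.
  (* The length is abstracted as [p] because [n] also occurs in the type of [a]. *)
  rewrite orbit_ordS; have -> p : p = n.-1.+1 -> traject (@ordS n) (ordS a) p
      = rcons (traject (@ordS n) (ordS a) n.-1) a => //; last by rewrite prednK.
  by move=> ->; rewrite trajectSr iter_a.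
have := mem_orbit_ordS (ordS a) i; have := orbit_uniq (@ordS n) (ordS a).
rewrite orbE rcons_uniq mem_rcons inE => /andP[a_notin _].
by have [-> _|] := eqVneq i a; first exact: negPf.
Qed.

Lemma ordS_neq a : 1 < n -> ordS a != a.
Proof.
move=> n_gt1; have /= := uniq_traject_ordS a n_gt1.
by rewrite inE andbT eq_sym.
Qed.

Lemma sum_delta (R : pzSemiRingType) j : (\sum_(i < n) (j == i)%:R = 1 :> R)%R.
Proof.
by rewrite (bigD1 j) //= eqxx big1 ?addr0 // => i; rewrite eq_sym => /negPf->.
Qed.

Lemma sum_delta_ordS (R : pzSemiRingType) j :
  (\sum_(i < n) (j == ordS i)%:R = 1 :> R)%R.
Proof.
rewrite -[RHS](sum_delta R j).
by rewrite [RHS](reindex_inj (@ordS_inj n)).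
Qed.

End Cyclic.

Lemma prod_Zp m (I : Type) (s : seq I) (F : I -> 'Z_m) :
  \prod_(i <- s) F i = (\sum_(i <- s) F i)%R.
Proof. by []. Qed.

(** All [m + 1] indices up to [m] exist since [m < n], so the full sum is [m + 1 = 1]; removing the
    term [j], which is 1, leaves 0. *)
Lemma sum_initial_segment n m (j : 'I_n) : 1 < m -> m < n -> j <= m ->
  (\sum_(i < n | i != j) (i <= m)%N%:R = 0 :> 'Z_m)%R.
Proof.
move=> m_gt1 lt_mn le_jm.
have : (\sum_(i < n) (i <= m)%N%:R = 1 :> 'Z_m)%R.
  rewrite -natr_sum -big_mkcond /= (big_ord_narrow lt_mn) sum1_card card_ord.
  by rewrite -natr1 pchar_Zp // add0r.
rewrite (bigD1 j) //= le_jm => /(canRL (addKr _)) ->.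
by rewrite addNr.
Qed.

(** * The wheel *)

Section Wheel.
Variable n : nat.
Implicit Types i j : 'I_n.
Local Notation Wn := (wheel n).

(** From the hub to [i], along [l] rim edges, and back to the hub. Length 1 gives the triangles,
    length [n - 1] their complements in the rim. *)
Definition sector i l : seq (dart Wn) :=
  (inr i, true)
    :: rcons [seq (inl j, true) | j <- traject (@ordS n) i l]
             (inr (iter l (@ordS n) i), false).

Lemma sector_edges i l :
  [seq d.1 | d <- sector i l]
    = inr i :: rcons [seq inl j | j <- traject (@ordS n) i l]
                     (inr (iter l (@ordS n) i)).
Proof. by rewrite /= map_rcons -map_comp. Qed.

Lemma mem_sector_rim i l j :
  ((inl j : edge Wn) \in edge_set (sector i l)) = (j \in traject (@ordS n) i l).
Proof.
rewrite mem_edge_set sector_edges inE mem_rcons inE /=.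
by rewrite mem_map // => ? ? [].
Qed.

Lemma mem_sector_spoke i l j :
  ((inr j : edge Wn) \in edge_set (sector i l))
    = (j == i) || (j == iter l (@ordS n) i).
Proof.
rewrite mem_edge_set sector_edges inE mem_rcons inE.
have /negPf-> : inr j \notin [seq inl j | j <- traject (@ordS n) i l].
  by apply/mapP=> -[].
by rewrite orbF.
Qed.

(** In a closed sector [d] and [d'] are both the outgoing spoke; they are separated because the
    induction on [l] changes [d]. *)
Lemma sector_path i l (d d' : dart Wn) :
    dart_head d = Some i -> dart_tail d' = None ->
  path (fun d1 d2 : dart Wn => dart_head d1 == dart_tail d2) d
    (rcons (rcons [seq (inl j, true) | j <- traject (@ordS n) i l]
                  (inr (iter l (@ordS n) i), false)) d').
Proof.
elim: l i d => [|l IHl] i d dh d't.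
  by rewrite /= dh d't /dart_tail /dart_head /= eqxx.
by rewrite iterSr /= dh eqxx /= IHl.
Qed.

Lemma simple_sector i l : 0 < l < n -> simple_closed_walk (sector i l).
Proof.
case/andP=> l_gt0 lt_ln; have Ut := uniq_traject_ordS i lt_ln.
apply/and4P; split=> //; last 1 first.
- rewrite sector_edges /= mem_rcons inE rcons_uniq.
  rewrite map_inj_uniq ?uniq_traject_ordS 1?ltnW // => [|? ? [] //].
  rewrite negb_or andbT -andbA; apply/and3P; split; try by apply/mapP=> -[].
  (* The two spokes differ: [i] is the first of the [l + 1] distinct rim vertices visited, and the
     return spoke leaves from the last. *)
  move: Ut; rewrite trajectSr rcons_uniq => /andP[+ _]; apply: contra.
  by case/eqP=> <-; case: l l_gt0 {lt_ln} => // l _; rewrite inE eqxx.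
- by rewrite /path.cycle /sector sector_path.
have -> : [seq dart_tail d | d <- sector i l]
    = None :: [seq Some j | j <- traject (@ordS n) i l.+1].
  by rewrite trajectSr /= !map_rcons -map_comp.
rewrite cons_uniq map_inj_uniq ?Ut ?andbT => [|? ? [] //].
by apply/mapP=> -[].
Qed.

Lemma sector_gain (G : groupType) (g : edge Wn -> G) i l :
    (forall j, g (inr j) = 1) ->
  walk_gain g (sector i l) = \prod_(j <- traject (@ordS n) i l) g (inl j).
Proof.
move=> g1; rewrite /walk_gain big_cons big_rcons big_map /dart_gain /= !g1.
by rewrite invg1 mulg1 mul1g.
Qed.

Definition triangle i := edge_set (sector i 1).

(* The boundary of the union of all triangles other than [triangle i]. *)
Definition co_triangle i := edge_set (sector (ordS i) n.-1).

Definition rim : {set edge Wn} := [set e | if e is inl _ then true else false].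

Hypothesis n_gt1 : 1 < n.

Lemma triangle_rimE i j :
  indicator (triangle i) (inl j) = ((j == i)%:R)%R.
Proof. by rewrite indicatorE mem_sector_rim inE. Qed.

Lemma triangle_spokeE i j :
  indicator (triangle i) (inr j) = ((j == i)%:R + (j == ordS i)%:R)%R.
Proof.
rewrite indicatorE mem_sector_spoke /=.
have [->|_] := eqVneq j i; last by rewrite add0r.
by rewrite eq_sym (negPf (ordS_neq i n_gt1)) addr0.
Qed.

Lemma triangle_co_triangle i :
  (indicator (triangle i) + indicator (co_triangle i) = indicator rim)%R.
Proof.
apply/ffunP=> -[j|j]; rewrite [LHS]ffunE !indicatorE [_ \in rim]inE.
  rewrite !mem_sector_rim mem_traject_ordS inE.
  by case: (j == i); rewrite ?addr0 ?add0r.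
(* The co-triangle runs from [ordS i] round to [i], so both circles use the same two spokes, which
   cancel. *)
rewrite !mem_sector_spoke -iterSr prednK 1?ltnW // iter_ordS_n orbC.
exact: F2_addvv.
Qed.

(** Each rim edge lies in one triangle; each spoke lies in the two triangles beside it and
    cancels. *)
Lemma sum_triangle : (\sum_i indicator (triangle i) = indicator rim)%R.
Proof.
apply/ffunP=> -[j|j]; rewrite sum_ffunE indicatorE [_ \in rim]inE.
  by under eq_bigr do rewrite triangle_rimE; rewrite sum_delta.
under eq_bigr do rewrite triangle_spokeE.
rewrite big_split /= sum_delta sum_delta_ordS; exact: val_inj.
Qed.

(* Subtracting triangles clears the rim edges of a binary cycle; a set of
   spokes of even degree at every rim vertex is empty. *)
Lemma triangles_span (U : {vspace edge_space Wn}) :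
  (forall i, indicator (triangle i) \in U) -> (cycle_space Wn <= U)%VS.
Proof.
move=> TU; apply/subvP=> x Zx.
pose t := (\sum_i x (inl i) *: indicator (triangle i))%R : edge_space Wn.
have Ut : t \in U by apply: memv_suml => i _; apply: memvZ.
suff y0 : (x - t = 0)%R by rewrite -(subrK t x) y0 add0r.
have : (x - t \in cycle_space Wn)%R.
  rewrite memvB // memv_suml // => i _; rewrite memvZ // mem_cycle_space.
  by apply: simple_closed_walk_binary; rewrite simple_sector.
case/cycle_spaceP=> D evD yE; rewrite yE.
have D_rim i : (inl i : edge Wn) \notin D.
  have : indicator D (inl i) = 0%R.
    rewrite -yE !ffunE sum_ffunE.
    under eq_bigr do rewrite ffunE triangle_rimE.
    rewrite (bigD1 i) //= eqxx big1 => [|j]; last first.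
      by rewrite eq_sym => /negPf->; apply: mulr0.
    by rewrite addr0 [(_ *: _)%R]mulr1 subrr.
  by rewrite indicatorE; case: (_ \in _).
apply/ffunP=> e; rewrite indicatorE ffunE; case: e => i.
  by rewrite (negPf (D_rim i)).
have /forallP/(_ (Some i)) := evD; rewrite /degree.
have -> : [set e in D | src e == Some i] = set0.
  apply/setP=> -[j|j]; rewrite !inE ?(negPf (D_rim j)) //=.
  by rewrite andbF.
have -> : [set e in D | tgt e == Some i] = D :&: [set inr i].
  apply/setP=> -[j|j]; rewrite !inE ?(negPf (D_rim j)) //=.
case: (boolP ((inr i : edge Wn) \in D)) => // Di.
by rewrite (setIidPr _) ?sub1set // cards0 cards1.
Qed.

Lemma wheel_bad (C : group_class) m :
  1 < m -> odd m -> m < n -> C 'Z_m -> bad C Wn.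
Proof.
move=> m_gt1 m_odd lt_mn CZ goodW.
pose g (e : edge Wn) : 'Z_m :=
  (* The last [1] is the group identity, hence the residue 0. *)
  if e is inl i then ((i <= m)%N%:R)%R else 1.
pose B i := if i < m.+1 then co_triangle i else triangle i.
have g1 j : g (inr j) = 1 by [].
have balB i : balanced_circle g (B i).
  rewrite /B ltnS; have [le_im | lt_mi] := leqP i m.
    exists (sector (ordS i) n.-1).
      split=> //; apply: simple_sector.
      by case: n i n_gt1 {le_im g B g1 lt_mn goodW} => // -[|] //= *.
    rewrite sector_gain // prod_Zp big_uniq ?uniq_traject_ordS ?leq_pred //=.
    under eq_bigl do rewrite mem_traject_ordS.
    exact: sum_initial_segment.
  exists (sector i 1); first by split=> //; rewrite simple_sector.
  by rewrite sector_gain // big_seq1 /= leqNgt lt_mi.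
pose i0 : 'I_n := Ordinal (ltnW n_gt1).
(* Destructing the negation leaves the premises, then [balanced g], which goodness must supply. *)
have [] := @unbalanced_single Wn _ g (triangle i0) (inl i0).
- by exists (sector i0 1); rewrite ?simple_sector.
- by rewrite mem_sector_rim inE.
- exact: (oner_neq0 'Z_m).
- case=> // j; rewrite mem_sector_rim inE => /eqP->; by rewrite eqxx.
apply: goodW => //.
apply: (@balanced_basis_of_span _ _ _ [seq B i | i : 'I_n]).
  by move=> D /imageP[i _ ->].
apply: triangles_span.
(* The triangles sum to the rim with no correction term, so [z] is 0. *)
apply: (complemented_family_mem (q := m.+1) _ _ triangle_co_triangle
          (z := 0%R)); rewrite /= ?m_odd //.
- by rewrite addr0 sum_triangle.
- exact: mem0v.
move=> i; rewrite -(fun_if (@indicator Wn)) memv_span //.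
by apply: map_f; apply: image_f.
Qed.

End Wheel.

(** * The doubled circle *)

Section DoubledCircle.
Variable n : nat.
Implicit Types (i j : 'I_n) (f : 'I_n -> bool).
Local Notation Cn := (doubled_circle n).

(** [f] selects the copy used at each position; [i] is only the starting point. *)
Definition hamiltonian f i : seq (dart Cn) :=
  [seq ((j, f j), true) | j <- fingraph.orbit (@ordS n) i].

Definition digon_walk i : seq (dart Cn) :=
  [:: ((i, true), true); ((i, false), false)].

Lemma mem_hamiltonian f i (e : edge Cn) :
  (e \in edge_set (hamiltonian f i)) = (e.2 == f e.1).
Proof.
rewrite mem_edge_set -map_comp.
apply/mapP/eqP => [[j _ ->] // | fe].
by exists e.1; rewrite ?mem_orbit_ordS //= -fe; case: e {fe}.
Qed.

Lemma simple_hamiltonian f i : simple_closed_walk (hamiltonian f i).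
Proof.
apply/and4P; split.
- apply/eqP=> h0; have := mem_orbit_ordS i i.
  by move: h0; rewrite /hamiltonian; case: fingraph.orbit.
- rewrite /hamiltonian cycle_map; exact: (cycle_orbit (@ordS_inj n)).
- by rewrite -map_comp map_inj_uniq ?orbit_uniq.
- by rewrite -map_comp map_inj_uniq ?orbit_uniq // => ? ? [].
Qed.

Lemma mem_digon i (e : edge Cn) :
  (e \in edge_set (digon_walk i)) = (e.1 == i).
Proof.
by rewrite mem_edge_set !inE; case: e => j [];
  rewrite /= !xpair_eqE ?andbT ?andbF ?orbF.
Qed.

Lemma simple_digon i : 1 < n -> simple_closed_walk (digon_walk i).
Proof.
move=> n_gt1; apply/and4P; split=> //=.
- by rewrite /dart_head /dart_tail /= !eqxx.
- by rewrite inE andbT eq_sym ordS_neq.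
- by rewrite inE xpair_eqE andbF.
Qed.

(** Both sides are the indicator of the whole edge set. *)
Lemma sum_digon i0 :
  (\sum_i indicator (edge_set (digon_walk i))
     = indicator (edge_set (hamiltonian (fun=> true) i0))
       + indicator (edge_set (hamiltonian (fun=> false) i0)))%R.
Proof.
apply/ffunP=> e; rewrite sum_ffunE [RHS]ffunE.
under eq_bigr do rewrite indicatorE mem_digon.
rewrite !indicatorE !mem_hamiltonian sum_delta.
by case: e.2; rewrite ?addr0 ?add0r.
Qed.

(** Adding the digon at [i] switches the copy used at position [i]. *)
Lemma digon_co_digon i i0 :
  (indicator (edge_set (digon_walk i))
     + indicator (edge_set (hamiltonian (fun j => j != i) i0))
   = indicator (edge_set (hamiltonian (fun=> true) i0)))%R.
Proof.
apply/ffunP=> e; rewrite [LHS]ffunE !indicatorE mem_digon !mem_hamiltonian.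
by case: e => j [] /=; case: (j == i); rewrite ?addr0 ?add0r //; apply: val_inj.
Qed.

(* Subtracting digons clears the [true] copies of a binary cycle; what
   remains has all or none of the [false] copies. *)
Lemma digons_span i0 (U : {vspace edge_space Cn}) : 1 < n ->
    (forall i, indicator (edge_set (digon_walk i)) \in U) ->
    indicator (edge_set (hamiltonian (fun=> false) i0)) \in U ->
  (cycle_space Cn <= U)%VS.
Proof.
move=> n_gt1 TU HU; apply/subvP=> x Zx.
pose t := (\sum_i x (i, true) *: indicator (edge_set (digon_walk i)))%R
  : edge_space Cn.
have Ut : t \in U by apply: memv_suml => i _; apply: memvZ.
suff Uy : (x - t \in U)%R by rewrite -(subrK t x) memvD.
have : (x - t \in cycle_space Cn)%R.
  rewrite memvB // memv_suml // => i _; rewrite memvZ // mem_cycle_space.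
  by apply: simple_closed_walk_binary; rewrite simple_digon.
case/cycle_spaceP=> D evD yE; rewrite yE.
have D_true i : ((i, true) : edge Cn) \notin D.
  have : indicator D (i, true) = 0%R.
    rewrite -yE !ffunE sum_ffunE.
    under eq_bigr do rewrite ffunE indicatorE mem_digon.
    rewrite (bigD1 i) //= eqxx big1 => [|j]; last first.
      by rewrite eq_sym => /negPf->; apply: mulr0.
    by rewrite addr0 [(_ *: _)%R]mulr1 subrr.
  by rewrite indicatorE; case: (_ \in _).
(* The vertex [ordS i] meets [D] at most in the [false] copies before and after it; even degree
   makes both present or both absent. *)
have D_step i : (((ordS i, false) : edge Cn) \in D)
    = (((i, false) : edge Cn) \in D).
  have /forallP/(_ (ordS i)) := evD; rewrite /degree.
  have cardE (p : pred (edge Cn)) (j : 'I_n) :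
      (forall e, p e = (e.1 == j)) ->
      #|[set e in D | p e]| = (((j, false) : edge Cn) \in D).
    move=> pE; have -> : [set e in D | p e] = D :&: [set (j, false)].
      apply/setP=> -[j' []]; rewrite !inE pE ?(negPf (D_true j')) //=.
      by rewrite xpair_eqE andbT.
    case: (boolP (_ \in D)) => Dj.
      by rewrite (setIidPr _) ?sub1set ?cards1.
    by apply/eqP; rewrite cards_eq0 setI_eq0 disjoint_sym disjoints1.
  rewrite (cardE _ (ordS i)) // (cardE _ i) => [|e]; last first.
    by rewrite /= (inj_eq (@ordS_inj n)).
  by case: (_ \in D); case: (_ \in D).
have D_false i : (((i, false) : edge Cn) \in D)
    = (((i0, false) : edge Cn) \in D).
  have /iter_findex <- := fconnect_ordS i0 i.
  by elim: findex => //= l <-; apply: D_step.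
have -> : indicator D = ((((i0, false) : edge Cn) \in D)%:R
    *: indicator (edge_set (hamiltonian (fun=> false) i0)))%R.
  apply/ffunP=> -[i b]; rewrite [RHS]ffunE !indicatorE mem_hamiltonian /=.
  case: b; first by rewrite (negPf (D_true i)) [RHS]mulr0.
  by rewrite D_false [RHS]mulr1.
exact: memvZ.
Qed.

(** Commutativity of ['Z_m] makes the order along the walk irrelevant. *)
Lemma hamiltonian_gain m (g : edge Cn -> 'Z_m) f i :
  walk_gain g (hamiltonian f i) = (\sum_j g (j, f j))%R.
Proof.
rewrite /walk_gain big_map prod_Zp big_uniq ?orbit_uniq //=.
by apply: eq_bigl => j; rewrite mem_orbit_ordS.
Qed.

Lemma doubled_circle_bad (C : group_class) m :
  1 < m -> odd m -> m < n -> C 'Z_m -> bad C Cn.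
Proof.
move=> m_gt1 m_odd lt_mn CZ goodC.
have n_gt1 := ltn_trans m_gt1 lt_mn.
pose g (e : edge Cn) : 'Z_m := ((e.2 && (e.1 <= m)%N)%:R)%R.
pose i0 : 'I_n := Ordinal (ltnW n_gt1).
pose co_digon i := edge_set (hamiltonian (fun j => j != i) i0).
pose B i := if i < m.+1 then co_digon i else edge_set (digon_walk i).
have balB i : balanced_circle g (B i).
  rewrite /B ltnS; have [le_im | lt_mi] := leqP i m.
    exists (hamiltonian (fun j => j != i) i0).
      by split=> //; apply: simple_hamiltonian.
    rewrite hamiltonian_gain -[RHS](sum_initial_segment m_gt1 lt_mn le_im).
    rewrite [RHS]big_mkcond /=; apply: eq_bigr => j _.
    by rewrite /g /=; case: (j != i).
  exists (digon_walk i); first by split=> //; rewrite simple_digon.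
  rewrite /walk_gain !big_cons big_nil /dart_gain /g /=.
  by rewrite leqNgt lt_mi invg1 !mulg1.
have [] := @unbalanced_single Cn _ g (edge_set (digon_walk i0)) (i0, true).
- by exists (digon_walk i0); rewrite ?simple_digon.
- by rewrite mem_digon.
- exact: (oner_neq0 'Z_m).
- by case=> j []; rewrite mem_digon //= => /eqP->; rewrite eqxx.
apply: goodC => //.
(* This circle has gain 0. It serves as the correction [z] between the sum of the digons and the
   [true] circle, and completes the digons to a spanning family. *)
pose H0 := edge_set (hamiltonian (fun=> false) i0).
apply: (@balanced_basis_of_span _ _ _ (H0 :: [seq B i | i : 'I_n])).
  move=> D; rewrite inE => /predU1P[-> | /imageP[i _ ->] //].
  exists (hamiltonian (fun=> false) i0).
    by split=> //; apply: simple_hamiltonian.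
  by rewrite hamiltonian_gain big1.
have UH0 : indicator H0 \in
    <<[seq indicator D | D <- H0 :: [seq B i | i : 'I_n]]>>%VS.
  by rewrite memv_span // mem_head.
apply: (digons_span n_gt1 _ UH0).
apply: (complemented_family_mem (q := m.+1) _ _ (digon_co_digon ^~ i0)
          (sum_digon i0) UH0); rewrite /= ?m_odd //.
move=> i; rewrite -(fun_if (@indicator Cn)) memv_span // inE.
by apply/orP; right; apply: map_f; apply: image_f.
Qed.

End DoubledCircle.

(** * Specialization to [m = 2j + 1] and [n = 2k] *)

Theorem theorem6p16 (C : group_class) (C_iso : iso_closed C)
    (C_sub : subgroup_closed C) (k : nat) (k_ge2 : (2 <= k)%N)
    (C_odd : exists2 j : nat, (1 <= j < k)%N & C 'Z_(j.*2.+1)) :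
  bad C (wheel k.*2) /\ bad C (doubled_circle k.*2).
Proof.
case: C_odd => j /andP[j_gt0 lt_jk] CZ.
have m_gt1 : 1 < j.*2.+1 by rewrite ltnS double_gt0.
have m_odd : odd j.*2.+1 by rewrite /= odd_double.
(* This reads [2(j + 1) <= 2k]. *)
have lt_mn : j.*2.+1 < k.*2 by rewrite -doubleS leq_double.
split; first by apply: wheel_bad CZ => //; apply: ltn_trans lt_mn.
exact: doubled_circle_bad CZ.
Qed.
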